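(* Let $n\ge 1$ be an integer and let $X$ be a non-empty set. The free injective solution (on $X$) in the category $\mathcal{RNS}_n$ of right nilpotent solutions of class at most $n$ has a solvable Word Problem.
   Context: A solution (to the Yang–Baxter equation) is a pair $(X,r)$ with $X$ a non-empty set and $r\colon X^2\to X^2$ a bijection with $(r\times\mathrm{id})(\mathrm{id}\times r)(r\times\mathrm{id})=(\mathrm{id}\times r)(r\times\mathrm{id})(\mathrm{id}\times r)$ on $X^3$, such that, writing $r(x,y)=(\lambda_x(y),\rho_y(x))$, all maps $\lambda_x,\rho_x$ are bijective. A morphism of solutions $f\colon(X,r)\to(Y,s)$ is a map $f\colon X\to Y$ with $(f\times f)r=s(f\times f)$. The structure group of $(X,r)$ is $G(X,r)=\langle X\mid x\circ y=u\circ v\text{ whenever } r(x,y)=(u,v)\rangle$; $(X,r)$ is called injective if the canonical map $X\to G(X,r)$ is injective. The free injective solution on $X$ in $\mathcal{RNS}_n$ is the free object on $X$ in the full subcategory of injective solutions belonging to $\mathcal{RNS}_n$, i.e. such a solution $F$ together with a map $i\colon X\to F$ such that each map from $X$ to an injective solution $K$ in $\mathcal{RNS}_n$ equals $\varphi\circ i$ for a unique morphism $\varphi\colon F\to K$. Definition of $\mathcal{RNS}_n$: for a solution $(X,r)$ let $W(X)$ be the submonoid of $X^X$ generated by all $\lambda_x^{\pm1},\rho_x^{\pm1}$ ($x\in X$) and all maps $D_z\colon X\to X$, $D_z(x)=\rho_x(z)$ ($z\in X$); write $m\cdot x$ for the action of $m\in W(X)$ on $x\in X$. For $k\ge1$,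 $\alpha\in\{\pm1\}^k$, $v\in X^k$, $m=(m_2,\dots,m_k)\in W(X)^{k-1}$, define $\lambda^{\alpha}_{m,v}\colon X\to X$ recursively: for $k=1$ it is $\lambda_{v_1}^{\alpha_1}$; for $k>1$ it is $\lambda_{z}^{\alpha_k}$ with $z=m_k\cdot\lambda^{(\alpha_1,\dots,\alpha_{k-1})}_{(m_2,\dots,m_{k-1}),(v_1,\dots,v_{k-1})}(v_k)$. The solution belongs to $\mathcal{RNS}_1$ if $\lambda_x=\mathrm{id}$ for all $x\in X$; for $n>1$ it belongs to $\mathcal{RNS}_n$ if $\lambda^{(\alpha_1,\dots,\alpha_n)}_{(m_2,\dots,m_n),(v_1,\dots,v_n)}=\lambda^{(\alpha_2,\dots,\alpha_n)}_{(m_3,\dots,m_n),(m_2\cdot v_2,v_3,\dots,v_n)}$ for all $\alpha\in\{\pm1\}^n$, $m\in W(X)^{n-1}$, $v\in X^n$. Morphisms in $\mathcal{RNS}_n$ are all morphisms of solutions. ''Word Problem'' is used in its usual informal sense for a free object (deciding algorithmically whether two expressions in the generators represent the same element); no more specific formalisation is fixed. *)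

(* Defs.v *)
From mathcomp Require Import all_boot.
From Stdlib Require List.

Set Implicit Arguments.
Unset Strict Implicit.
Unset Printing Implicit Defensive.

Definition r12 (X : Type) (r : X * X -> X * X) (t : X * X * X) : X * X * X :=
  (r (t.1.1, t.1.2), t.2).

Definition r23 (X : Type) (r : X * X -> X * X) (t : X * X * X) : X * X * X :=
  let (y, z) := r (t.1.2, t.2) in (t.1.1, y, z).

(* r (x, y) = (lam x y, rho y x).  The (unique) inverses of the bijections r,
   lam x and rho x are carried as data, so that they are available as functions
   on arbitrary carriers. *)
Record solution : Type := Solution {
  carrier :> Type;
  carrier_inhabited : inhabited carrier;
  r : carrier * carrier -> carrier * carrier;
  rV : carrier * carrier -> carrier * carrier;
  lam : carrier -> carrier -> carrier := fun x y => (r (x, y)).1;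
  rho : carrier -> carrier -> carrier := fun y x => (r (x, y)).2;
  lamV : carrier -> carrier -> carrier;
  rhoV : carrier -> carrier -> carrier;
  rK : cancel r rV;
  rVK : cancel rV r;
  lamK : forall x, cancel (lam x) (lamV x);
  lamVK : forall x, cancel (lamV x) (lam x);
  rhoK : forall x, cancel (rho x) (rhoV x);
  rhoVK : forall x, cancel (rhoV x) (rho x);
  yang_baxter : r12 r \o r23 r \o r12 r =1 r23 r \o r12 r \o r23 r
}.

Definition is_morphism (K L : solution) (f : K -> L) : Prop :=
  forall x y, r (f x, f y) = (f (r (x, y)).1, f (r (x, y)).2).

(* The structure group is the quotient of the words in the letters
   x = (true, x) and x^-1 = (false, x) by this congruence. *)
Inductive structure_group_eq (K : solution) :
    seq (bool * K) -> seq (bool * K) -> Prop :=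
| sg_refl u : structure_group_eq u u
| sg_sym u v : structure_group_eq u v -> structure_group_eq v u
| sg_trans u v w :
    structure_group_eq u v -> structure_group_eq v w -> structure_group_eq u w
| sg_cancel u a x w :
    structure_group_eq (u ++ [:: (a, x); (~~ a, x)] ++ w) (u ++ w)
| sg_rel u x y w :
    structure_group_eq (u ++ [:: (true, x); (true, y)] ++ w)
                       (u ++ [:: (true, lam x y); (true, rho y x)] ++ w).

Definition injective_solution (K : solution) : Prop :=
  forall x y : K, structure_group_eq [:: (true, x)] [:: (true, y)] -> x = y.

(* Signs are booleans, with true standing for +1. *)
Definition lam_sign (K : solution) (a : bool) (x : K) : K -> K :=
  if a then lam x else lamV x.

Definition rho_sign (K : solution) (a : bool) (x : K) : K -> K :=
  if a then rho x else rhoV x.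

Inductive in_W (K : solution) : (K -> K) -> Prop :=
| W_id : in_W id
| W_comp f g : in_W f -> in_W g -> in_W (f \o g)
| W_lam a x : in_W (lam_sign a x)
| W_rho a x : in_W (rho_sign a x)
| W_D z : in_W (fun x => rho x z).

(* The map lambda^alpha_{m,v} with alpha = (a1, ..., ak), v = (v1, ..., vk) and
   m = (m2, ..., mk) is [lam_iter a1 v1 [:: (a2, m2, v2); ...; (ak, mk, vk)]];
   its recursion peels off the last entry, hence foldl. *)
Definition lam_iter (K : solution) (a1 : bool) (v1 : K)
    (s : seq (bool * (K -> K) * K)) : K -> K :=
  foldl (fun f (e : bool * (K -> K) * K) =>
           let: (a, m, v) := e in lam_sign a (m (f v)))
        (lam_sign a1 v1) s.

(* The class is only meaningful for n >= 1. *)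
Definition RNS (n : nat) (K : solution) : Prop :=
  match n with
  | 0 => False
  | 1 => forall x y : K, lam x y = y
  | k.+2 =>
      forall (a1 a2 : bool) (v1 v2 : K) (m2 : K -> K)
             (s : seq (bool * (K -> K) * K)),
        size s = k -> in_W m2 -> List.Forall (fun e => in_W e.1.2) s ->
        lam_iter a1 v1 ((a2, m2, v2) :: s) =1 lam_iter a2 (m2 v2) s
  end.

Definition is_free_injective (n : nat) (X : Type) (F : solution) (i : X -> F) :
    Prop :=
  [/\ injective_solution F, RNS n F &
      forall K : solution, injective_solution K -> RNS n K ->
      forall g : X -> K,
      exists phi : F -> K,
        [/\ is_morphism phi, phi \o i =1 g &
            forall psi : F -> K, is_morphism psi -> psi \o i =1 g ->
                                 psi =1 phi]].

Inductive op := OpLam | OpLamV | OpRho | OpRhoV | OpRV1 | OpRV2.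

Definition op_val (K : solution) (o : op) (x y : K) : K :=
  match o with
  | OpLam => lam x y
  | OpLamV => lamV x y
  | OpRho => rho x y
  | OpRhoV => rhoV x y
  | OpRV1 => (rV (x, y)).1
  | OpRV2 => (rV (x, y)).2
  end.

(* The operations are those of solutions viewed as a variety: both components
   of r and of its inverse, and the inverses of lam x and rho x.  They generate
   the whole free solution from the image of X. *)
Inductive term (X : Type) :=
| Var of X
| App of op & term X & term X.

Fixpoint term_val (X : Type) (K : solution) (i : X -> K) (t : term X) : K :=
  match t with
  | Var x => i x
  | App o s1 s2 => op_val o (term_val i s1) (term_val i s2)
  end.

Fixpoint occurs (X : Type) (x : X) (t : term X) : Prop :=
  match t with
  | Var y => x = y
  | App _ s1 s2 => occurs x s1 \/ occurs x s2
  end.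

(* A bool-valued Rocq function is no substitute for an algorithm: in the
   presence of classical axioms it exists for every predicate.  Algorithms are
   therefore programs in an explicit Turing-complete language: the partial
   recursive functions on binary trees, a tree being its own data format for
   pairs, numbers and terms. *)
Inductive tree := Leaf | Node of tree & tree.

Inductive prog :=
| PId
| PLeaf
| PFst
| PSnd
| PPair of prog & prog
| PComp of prog & prog
| PRec of prog & prog
| PWhile of prog & prog.

Definition tfst (t : tree) : tree := if t is Node a _ then a else Leaf.
Definition tsnd (t : tree) : tree := if t is Node _ b then b else Leaf.

(* [exec p x y]: the program p halts on input x with output y.
   PRec f g is primitive recursion on the second component of the input, with
   the first one as parameter; PWhile f g iterates g as long as the test f does
   not return Leaf. *)
Inductive exec : prog -> tree -> tree -> Prop :=
| ex_id x : exec PId x x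
| ex_leaf x : exec PLeaf x Leaf
| ex_fst x : exec PFst x (tfst x)
| ex_snd x : exec PSnd x (tsnd x)
| ex_pair f g x y z :
    exec f x y -> exec g x z -> exec (PPair f g) x (Node y z)
| ex_comp f g x y z : exec g x y -> exec f y z -> exec (PComp f g) x z
| ex_rec_none f g : exec (PRec f g) Leaf Leaf
| ex_rec_leaf f g a y : exec f a y -> exec (PRec f g) (Node a Leaf) y
| ex_rec_node f g a t1 t2 y1 y2 y :
    exec (PRec f g) (Node a t1) y1 -> exec (PRec f g) (Node a t2) y2 ->
    exec g (Node a (Node (Node t1 t2) (Node y1 y2))) y ->
    exec (PRec f g) (Node a (Node t1 t2)) y
| ex_while_stop f g x : exec f x Leaf -> exec (PWhile f g) x x
| ex_while_step f g x b1 b2 y z :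
    exec f x (Node b1 b2) -> exec g x y -> exec (PWhile f g) y z ->
    exec (PWhile f g) x z.

Lemma exec_functional p x y z : exec p x y -> exec p x z -> y = z.
Proof.
move=> H; revert z; induction H; intros w Hw; inversion Hw; subst;
  repeat match goal with
  | IH : forall z, exec ?p ?x z -> _ = z, E : exec ?p ?x _ |- _ =>
      apply IH in E; try discriminate E; try (injection E as ? ?); subst
  end; reflexivity.
Qed.

Fixpoint code_nat (k : nat) : tree :=
  if k is k'.+1 then Node Leaf (code_nat k') else Leaf.

Definition code_bool (b : bool) : tree := code_nat b.

Definition code_op (o : op) : tree :=
  code_nat match o with
           | OpLam => 0 | OpLamV => 1 | OpRho => 2
           | OpRhoV => 3 | OpRV1 => 4 | OpRV2 => 5
           end.

(* The generator x is presented to the algorithm by its label c x. *)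
Fixpoint code_term (X : Type) (c : X -> nat) (t : term X) : tree :=
  match t with
  | Var x => Node Leaf (code_nat (c x))
  | App o s1 s2 =>
      Node (Node Leaf (code_op o)) (Node (code_term c s1) (code_term c s2))
  end.

(* As X is an arbitrary set, possibly uncountable, the finitely many generators
   occurring in the input are named by pairwise distinct natural numbers.  For
   X = nat or X = 'I_m one may take the obvious labelling. *)
Definition word_problem_solvable (X : Type) (F : solution) (i : X -> F) :
    Prop :=
  exists p : prog, forall (s t : term X) (c : X -> nat),
    (forall x y, occurs x s \/ occurs x t -> occurs y s \/ occurs y t ->
       c x = c y -> x = y) ->
    exists b : bool,
      exec p (Node (code_term c s) (code_term c t)) (code_bool b) /\
      (b = true <-> term_val i s = term_val i t).

(* Main.v *)
Require Import Defs.
From mathcomp Require Import all_boot.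
From HB Require Import structures.
From Stdlib Require List.

Set Implicit Arguments.
Unset Strict Implicit.
Unset Printing Implicit Defensive.

(* A skew brace is a group with a lambda-action, and gives an injective
   solution.  Let L_0 be trivial and L_(n+1) the free group on L_n * nat, with
   lambda_a (g, x) = (pi a o g, x), where pi : L_(n+1) -> L_n forgets the
   innermost level and a o b = a * lambda_a b.  Each L_n is a skew brace, and
   since lambda_a only depends on pi a, its solution belongs to RNS_n.  By
   freeness, terms that agree in the free solution agree in L_n, where equality
   is decided by nested free reduction.
   Conversely, let K be injective and in RNS_n.  A word of L_n is read as an
   element of the structure group of K.  Nilpotency makes the permutation
   lambda_g of K depend only on the class of g in L_(n-1), so the reading is
   compatible with equality in L_n.  The word of a term is read as the value of
   the term in K, which is determined by it because K is injective. *)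

(** * Solutions from skew braces *)

Section BraceOp.
Variables (T : Type) (mul : T -> T -> T) (inv bar : T -> T).
Variable lam : T -> T -> T.

(** Stated over raw operations so that the same formulas serve for braces, unreduced words and
    trees. *)
Definition brace_op (o : op) (x y : T) : T :=
  match o with
  | OpLam => lam x y
  | OpLamV => lam (bar x) y
  | OpRho => lam (bar (lam y x)) (mul (inv (lam y x)) (mul y (lam y x)))
  | OpRhoV => bar (inv (mul x (mul (lam x (lam (bar y) y)) (inv x))))
  | OpRV1 => mul x (mul (lam x y) (inv x))
  | OpRV2 => lam (bar (mul x (mul (lam x y) (inv x)))) x
  end.
End BraceOp.

(* The second group law of the skew brace is a o b = a * blam a b, and bar is
   its inverse. *)
Record brace : Type := Brace {
  brace_sort :> Type;
  bone : brace_sort;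
  bmul : brace_sort -> brace_sort -> brace_sort;
  binv : brace_sort -> brace_sort;
  bbar : brace_sort -> brace_sort;
  blam : brace_sort -> brace_sort -> brace_sort;
  bmulA : associative bmul;
  bmul1 : left_id bone bmul;
  bmulV : left_inverse bone binv bmul;
  blamM : forall a, {morph blam a : b c / bmul b c};
  blam1 : forall b, blam bone b = b;
  blam_circ : forall a b c, blam (bmul a (blam a b)) c = blam a (blam b c);
  bbarl : forall a, bmul (bbar a) (blam (bbar a) a) = bone;
  bbarr : forall a, bmul a (blam a (bbar a)) = bone
}.

Section BraceSolution.
Variable B : brace.
Implicit Types a b c x y z : B.
Local Notation "1" := (bone B).
Local Notation "x * y" := (bmul x y).
Local Notation "x ^-1" := (binv x).
Local Notation bop := (@brace_op B (@bmul B) (@binv B) (@bbar B) (@blam B)).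

Definition circ x y := x * blam x y.
Local Notation "x ** y" := (circ x y) (at level 40, left associativity).

Lemma bmulrV x : x * x^-1 = 1.
Proof.
by rewrite -[LHS]bmul1 -{1}(bmulV x^-1) -bmulA (bmulA x^-1) bmulV bmul1 bmulV.
Qed.

Lemma bmulr1 x : x * 1 = x.
Proof. by rewrite -(bmulV x) bmulA bmulrV bmul1. Qed.

Lemma bmulKV x y : x^-1 * (x * y) = y.
Proof. by rewrite bmulA bmulV bmul1. Qed.

Lemma bmulVK x y : x * (x^-1 * y) = y.
Proof. by rewrite bmulA bmulrV bmul1. Qed.

Lemma bmulI x : injective (bmul x).
Proof. by move=> y z e; rewrite -(bmulKV x y) e bmulKV. Qed.

Lemma binv_eq x y : x * y = 1 -> x^-1 = y.
Proof. by move=> e; apply: (@bmulI x); rewrite bmulrV. Qed.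

Lemma binvK x : x^-1^-1 = x.
Proof. by apply: binv_eq; rewrite bmulV. Qed.

Lemma binvM x y : (x * y)^-1 = y^-1 * x^-1.
Proof. by apply: binv_eq; rewrite -bmulA bmulVK bmulrV. Qed.

Lemma blam_one a : blam a 1 = 1.
Proof. by apply: (@bmulI (blam a 1)); rewrite -blamM bmul1 bmulr1. Qed.

Lemma blamV a b : blam a b^-1 = (blam a b)^-1.
Proof. by apply/esym/binv_eq; rewrite -blamM bmulrV blam_one. Qed.

Lemma blam_circE x y z : blam (x ** y) z = blam x (blam y z).
Proof. exact: blam_circ. Qed.

Lemma circA x y z : x ** (y ** z) = x ** y ** z.
Proof. by rewrite /circ blam_circ blamM bmulA. Qed.

Lemma circ1 x : 1 ** x = x.
Proof. by rewrite /circ blam1 bmul1. Qed.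

Lemma circr1 x : x ** 1 = x.
Proof. by rewrite /circ blam_one bmulr1. Qed.

Lemma circVK x y : x ** (bbar x ** y) = y.
Proof. by rewrite circA [x ** bbar x]bbarr circ1. Qed.

Lemma circKV x y : bbar x ** (x ** y) = y.
Proof. by rewrite circA [bbar x ** x]bbarl circ1. Qed.

Lemma circI x : injective (circ x).
Proof. by move=> y z e; rewrite -(circKV x y) e circKV. Qed.

Lemma circ_inj x y z : y ** x = z ** x -> y = z.
Proof.
move=> /(congr1 (fun u => u ** bbar x)).
by rewrite -!circA [x ** bbar x]bbarr !circr1.
Qed.

Lemma bbar_eq x y : x ** y = 1 -> bbar x = y.
Proof. by move=> e; apply: (@circI x); rewrite [LHS]bbarr. Qed.

Lemma bbarK x : bbar (bbar x) = x.
Proof. by apply: bbar_eq; exact: bbarl. Qed.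

Lemma blamK a : cancel (blam a) (blam (bbar a)).
Proof. by move=> b; rewrite -blam_circ bbarl blam1. Qed.

Lemma blamVK a : cancel (blam (bbar a)) (blam a).
Proof. by move=> b; rewrite -blam_circ bbarr blam1. Qed.

Lemma circ_lam_rho x y : blam x y ** bop OpRho y x = x ** y.
Proof. by rewrite /circ /= blamVK bmulVK. Qed.

Lemma bop_rVK x y :
  let z := bop OpRV1 x y in
  blam z (bop OpRV2 x y) = x /\ bop OpRho (bop OpRV2 x y) z = y.
Proof.
rewrite /= blamVK; split=> //.
by rewrite -!bmulA bmulV bmulr1 bmulKV blamK.
Qed.

Lemma bop_rK x y :
  bop OpRV1 (blam x y) (bop OpRho y x) = x /\
  bop OpRV2 (blam x y) (bop OpRho y x) = y.
Proof.
have E : bop OpRV1 (blam x y) (bop OpRho y x) = x.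
  by rewrite /= blamVK -!bmulA bmulrV bmulr1 bmulVK.
by split=> //; rewrite -[LHS]/(blam (bbar (bop OpRV1 _ _)) _) E blamK.
Qed.

(** With [z = bop OpRhoV x y], this is the equation [blam z x ** y = z ** x] that characterises [z],
    multiplied on the left by [bbar z] and on the right by [bbar y]. *)
Lemma bar_rhoV x y : bbar (bop OpRhoV x y) * x = x ** bbar y.
Proof.
have -> : bbar (bop OpRhoV x y) = (x ** bbar y) * x^-1; last first.
  by rewrite -bmulA bmulV bmulr1.
rewrite /= bbarK !binvM binvK -blamV; congr (_ * blam x _ * _).
by apply: binv_eq; apply: (@bmulI (bbar y)); rewrite bmulA bbarl bmul1 bmulr1.
Qed.

Lemma bop_rhoVK x : cancel (bop OpRhoV x) (bop OpRho x).
Proof.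
move=> y; set z := bop OpRhoV x y.
apply: (@circI (blam z x)); rewrite circ_lam_rho.
apply: (@circI (bbar z)); rewrite circKV circA.
rewrite [bbar z ** blam z x]/circ blamK bar_rhoV -circA.
by rewrite [bbar y ** y]bbarl circr1.
Qed.

Lemma bop_rhoK x : cancel (bop OpRho x) (bop OpRhoV x).
Proof.
move=> z; set y := bop OpRho x z.
suff E : bbar (bop OpRhoV x y) = bbar z.
  by rewrite -[LHS]bbarK E bbarK.
suff : bbar (bop OpRhoV x y) * x = bbar z * x.
  by move=> /(congr1 (fun u => u * x^-1)); rewrite -!bmulA bmulrV !bmulr1.
rewrite bar_rhoV; apply: (@circ_inj y).
rewrite -circA [bbar y ** y]bbarl circr1.
by rewrite -{2}(blamK z x) -[_ * _]/(_ ** _) -circA circ_lam_rho circKV.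
Qed.

Lemma blam_circ_rho x y z :
  blam x (y ** z) = blam x y ** blam (bop OpRho y x) z.
Proof.
rewrite {1}/circ blamM [RHS]/circ; congr (_ * _).
by rewrite -!blam_circE circ_lam_rho.
Qed.

Lemma bop_rho_circ x y z :
  bop OpRho z (bop OpRho y x) = bop OpRho (y ** z) x.
Proof.
apply: (@circI (blam x (y ** z))); rewrite circ_lam_rho.
by rewrite blam_circ_rho -circA circ_lam_rho !circA circ_lam_rho.
Qed.

Definition brace_r (p : B * B) : B * B := (bop OpLam p.1 p.2, bop OpRho p.2 p.1).
Definition brace_rV (p : B * B) : B * B :=
  (bop OpRV1 p.1 p.2, bop OpRV2 p.1 p.2).

Lemma brace_rK : cancel brace_r brace_rV.
Proof. by case=> x y; have [e1 e2] := bop_rK x y; congr pair. Qed.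

Lemma brace_rVK : cancel brace_rV brace_r.
Proof. by case=> x y; have [e1 e2] := bop_rVK x y; congr pair. Qed.

Lemma brace_yang_baxter :
  r12 brace_r \o r23 brace_r \o r12 brace_r =1
  r23 brace_r \o r12 brace_r \o r23 brace_r.
Proof.
case=> [[x y] z].
change ((blam (blam x y) (blam (bop OpRho y x) z),
         bop OpRho (blam (bop OpRho y x) z) (blam x y),
         bop OpRho z (bop OpRho y x)) =
        (blam x (blam y z),
         blam (bop OpRho (blam y z) x) (bop OpRho z y),
         bop OpRho (bop OpRho z y) (bop OpRho (blam y z) x))).
have e1 : blam (blam x y) (blam (bop OpRho y x) z) = blam x (blam y z).
  by rewrite -!blam_circE circ_lam_rho.
have e3 : bop OpRho z (bop OpRho y x) =
    bop OpRho (bop OpRho z y) (bop OpRho (blam y z) x).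
  by rewrite !bop_rho_circ circ_lam_rho.
rewrite e1 e3; congr (_, _, _).
(* The outer components agree and both triples have circle product [x ** y ** z], so the middle ones
   agree by cancellation. *)
apply: (@circI (blam x (blam y z))).
apply: (@circ_inj (bop OpRho (bop OpRho z y) (bop OpRho (blam y z) x))).
transitivity (x ** y ** z).
  by rewrite -{1}e1 circ_lam_rho -e3 -circA circ_lam_rho circA circ_lam_rho.
rewrite -[RHS]circA circ_lam_rho [RHS]circA circ_lam_rho -[RHS]circA.
by rewrite circ_lam_rho circA.
Qed.

Definition brace_solution : solution :=
  @Solution B (inhabits 1) brace_r brace_rV (bop OpLamV) (bop OpRhoV)
    brace_rK brace_rVK blamK blamVK bop_rhoK bop_rhoVK brace_yang_baxter.

Lemma op_val_brace_solution o (x y : brace_solution) :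
  op_val o x y = bop o x y.
Proof. by case: o. Qed.

(* The inclusion of B into its structure group is split by the evaluation of
   words in the group (B, o). *)
Lemma brace_solution_injective : injective_solution brace_solution.
Proof.
pose ev (u : seq (bool * B)) :=
  foldr (fun e => circ (if e.1 then e.2 else bbar e.2)) 1 u.
have ev_cat u v : ev (u ++ v) = ev u ** ev v.
  by elim: u => [|e u IHu] /=; rewrite ?circ1 // IHu circA.
suff H u v : @structure_group_eq brace_solution u v -> ev u = ev v.
  by move=> x y /H; rewrite /= !circr1.
elim=> {u v} //.
- by move=> u v w _ -> _ ->.
- by move=> u [] x w; rewrite !ev_cat /= circr1 -(circA _ _ (ev w)) ?circVK ?circKV.
- move=> u x y w; rewrite !ev_cat; congr (_ ** (_ ** _)).
  by rewrite /= !circr1 [RHS]circ_lam_rho.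
Qed.

End BraceSolution.

(** * Nested free groups *)

(* The letter (s, g, x) stands for (lambda_g x)^{+1} or (lambda_g x)^{-1},
   where g is again a word and x names a generator. *)
Inductive word : Type :=
| Nil
| Cons of bool & word & nat & word.

Lemma word_comparable : comparable word.
Proof.
by move=> u v; rewrite /decidable; decide equality;
  exact: eq_comparable.
Qed.
HB.instance Definition _ := hasDecEq.Build word (compareP word_comparable).

Fixpoint app u v :=
  match u with
  | Nil => v
  | Cons s g x u => Cons s g x (app u v)
  end.

Fixpoint inv u :=
  match u with
  | Nil => Nil
  | Cons s g x u => app (inv u) (Cons (~~ s) g x Nil)
  end.

(** On letters, lambda_a (lambda_g x) = lambda_(a o g) x, where a o g is [app a (lamw a g)]. *)
Fixpoint lamw a u :=
  match u with
  | Nil => Nil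
  | Cons s g x u => Cons s (app a (lamw a g)) x (lamw a u)
  end.

(* The inverse of u for the law a o b = app a (lamw a b), in L_n only. *)
Fixpoint bar n u :=
  match n with
  | 0 => Nil
  | n.+1 => lamw (bar n u) (inv u)
  end.

Lemma appA u v w : app u (app v w) = app (app u v) w.
Proof. by elim: u => //= s g _ x u ->. Qed.

Lemma appN u : app u Nil = u.
Proof. by elim: u => //= s g _ x u ->. Qed.

Lemma lamw_app a u v : lamw a (app u v) = app (lamw a u) (lamw a v).
Proof. by elim: u => //= s g _ x u ->. Qed.

Lemma lamw_inv a u : lamw a (inv u) = inv (lamw a u).
Proof. by elim: u => //= s g _ x u IHu; rewrite lamw_app IHu. Qed.

Lemma lamw_Nil u : lamw Nil u = u.
Proof. by elim: u => //= s g -> x u ->. Qed.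

Lemma lamw_circ a b u : lamw (app a (lamw a b)) u = lamw a (lamw b u).
Proof.
by elim: u => //= s g -> x u ->; rewrite lamw_app appA.
Qed.

Inductive free_eq (R : word -> word -> Prop) : word -> word -> Prop :=
| free_refl u : free_eq R u u
| free_sym u v : free_eq R u v -> free_eq R v u
| free_trans u v w : free_eq R u v -> free_eq R v w -> free_eq R u w
| free_cons s g h x u v :
    R g h -> free_eq R u v -> free_eq R (Cons s g x u) (Cons s h x v)
| free_cancel s g x u :
    free_eq R (Cons s g x (Cons (~~ s) g x u)) u.

(* The words modulo weq n form the group L_n. *)
Fixpoint weq n : word -> word -> Prop :=
  if n is n.+1 then free_eq (weq n) else fun _ _ => True.

Lemma weq_refl n u : weq n u u.
Proof. by case: n => //= n; exact: free_refl. Qed.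

Lemma weq_sym n u v : weq n u v -> weq n v u.
Proof. by case: n => //= n; exact: free_sym. Qed.

Lemma weq_trans n u v w : weq n u v -> weq n v w -> weq n u w.
Proof. by case: n => //= n; exact: free_trans. Qed.

Lemma weqW n u v : weq n.+1 u v -> weq n u v.
Proof.
elim: n u v => // n IHn u v; elim=> {u v} /=.
- exact: free_refl.
- by move=> u v _; exact: free_sym.
- by move=> u v w _ + _; exact: free_trans.
- by move=> s g h x u v /IHn gh _; exact: free_cons.
- by move=> s g x u; exact: free_cancel.
Qed.

Lemma weq_le m n u v : m <= n -> weq n u v -> weq m u v.
Proof.
by elim: n => [|n IHn]; rewrite leq_eqVlt => /predU1P[-> //|] // /IHn + /weqW.
Qed.

Lemma weq_app n u u' v v' :
  weq n u u' -> weq n v v' -> weq n (app u v) (app u' v').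
Proof.
case: n => // n /= uu' vv'; apply: (@free_trans _ _ (app u v')).
  by elim: u {uu'} => //= s g _ x u; apply: free_cons; exact: weq_refl.
elim: uu' {vv'} => {u u'} /=.
- by move=> *; exact: free_refl.
- by move=> u w _; exact: free_sym.
- by move=> u v1 v2 _ + _; exact: free_trans.
- by move=> s g h x u w gh _; exact: free_cons.
- by move=> s g x u; exact: free_cancel.
Qed.

Lemma weq_cat_inv n u : weq n (app u (inv u)) Nil.
Proof.
case: n => // n; elim: u => [|s g _ x u IHu] /=; first exact: free_refl.
rewrite appA; apply: free_trans (free_cancel _ s g x Nil).
apply: free_cons (weq_refl _ _) _.
exact: (weq_app (n := n.+1) IHu (weq_refl _ _)).
Qed.

Lemma weq_inv_cat n u : weq n (app (inv u) u) Nil.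
Proof.
case: n => // n; elim: u => [|s g _ x u IHu] /=; first exact: free_refl.
rewrite -appA /=; apply: free_trans IHu.
apply: (weq_app (n := n.+1) (weq_refl _ _)).
by have := free_cancel (weq n) (~~ s) g x u; rewrite negbK.
Qed.

Lemma weq_inv n u v : weq n u v -> weq n (inv u) (inv v).
Proof.
move=> uv; rewrite -[inv u]appN.
have := weq_app (weq_refl n (inv u)) (weq_sym (weq_cat_inv n v)).
move/weq_trans; apply; rewrite appA -[X in weq _ _ X]/(app Nil (inv v)).
apply: weq_app (weq_refl _ _).
apply: weq_trans (weq_inv_cat n u).
by apply: weq_app (weq_refl _ _) (weq_sym uv).
Qed.

(** The index [a] enters only the inner words of the letters, which count modulo [weq n] in
    [weq n.+1]. This gain of one level yields both nilpotency and the convergence of [bar]. *)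
Lemma weq_lamw n a b u v :
  weq n a b -> weq n.+1 u v -> weq n.+1 (lamw a u) (lamw b v).
Proof.
elim: n a b u v => [|n IHn] a b u v ab uv; apply: (@free_trans _ _ (lamw a v)).
- elim: uv => {u v} /=.
  + by move=> *; exact: free_refl.
  + by move=> u w _; exact: free_sym.
  + by move=> u v1 v2 _ + _; exact: free_trans.
  + by move=> *; exact: free_cons.
  + by move=> s g x u; exact: free_cancel.
- by elim: v {uv} => [|s g _ x w IHw] /=; [exact: free_refl | exact: free_cons].
- elim: uv => {u v} /=.
  + by move=> *; exact: free_refl.
  + by move=> u w _; exact: free_sym.
  + by move=> u v1 v2 _ + _; exact: free_trans.
  + move=> s g h x u v gh _; apply: free_cons.
    apply: (weq_app (n := n.+1)) (weq_refl _ _) _.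
    by apply: IHn gh; exact: weq_refl.
  + by move=> s g x u; exact: free_cancel.
- elim: v {uv} => [|s g _ x w IHw] /=; first exact: free_refl.
  apply: free_cons IHw; apply: (weq_app (n := n.+1)) => //.
  by apply: IHn (weq_refl _ _); exact: weqW.
Qed.

Lemma weq_lamw_same n a b u v :
  weq n a b -> weq n u v -> weq n (lamw a u) (lamw b v).
Proof. by case: n => // n /weqW; exact: weq_lamw. Qed.

Lemma weq_bar m n u v : weq n u v -> weq n (bar m u) (bar m v).
Proof.
elim: m n => [|m IHm] n uv; first exact: weq_refl.
by apply: weq_lamw_same; [exact: IHm | exact: weq_inv].
Qed.

(** The circle inverse of u is the fixed point of b |-> [lamw b (inv u)]. By [weq_lamw] each
    iteration gains one level, so the n-th iterate is fixed in L_n. *)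
Lemma weq_barS n u : weq n (bar n u) (bar n.+1 u).
Proof. by elim: n => // n IHn; exact: weq_lamw IHn (weq_refl _ _). Qed.

Lemma weq_bar_circ n u : weq n (app (bar n u) (lamw (bar n u) u)) Nil.
Proof.
apply: weq_trans (weq_inv_cat n (lamw (bar n u) u)).
by rewrite -lamw_inv; apply: weq_app (weq_refl _ _); exact: weq_barS.
Qed.

Lemma weq_circ_bar n u : weq n (app u (lamw u (bar n u))) Nil.
Proof.
(* The left side becomes u * lambda_a (inv u) with a = u o bar n u; by induction a is trivial in
   L_n, which suffices at level n + 1. *)
elim: n => // n IHn; rewrite [bar _ _]/= -lamw_circ.
apply: weq_trans (weq_cat_inv n.+1 u).
apply: weq_app (weq_refl n.+1 u) _.
rewrite -[inv u in X in weq _ _ X]lamw_Nil.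
exact: weq_lamw IHn (weq_refl _ _).
Qed.

(** * Normal forms by nested free reduction *)

Definition cancels s g x w :=
  if w is Cons s' g' x' _ then [&& s' == ~~ s, g' == g & x' == x] else false.

Definition wtail w := if w is Cons _ _ _ w' then w' else Nil.

Definition push s g x w := if cancels s g x w then wtail w else Cons s g x w.

(** Inner words are normalised first, so that equality of letters modulo the lower level becomes
    syntactic. *)
Fixpoint nf n u :=
  if n is n.+1 then
    (fix nfS u :=
       if u is Cons s g x u then push s (nf n g) x (nfS u) else Nil) u
  else Nil.

Fixpoint reduced w :=
  if w is Cons s g x w' then reduced w' && ~~ cancels s g x w' else true.

Lemma push_reduced s g x w : reduced w -> reduced (push s g x w).
Proof.
rewrite /push; case: ifP => [|c r]; last by rewrite /= r c.
by case: w => //= s' g' x' w _ /andP[].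
Qed.

Lemma nf_reduced n u : reduced (nf n u).
Proof. by case: n => // n; elim: u => //= *; exact: push_reduced. Qed.

(** If the first push cancels the head of [w], the second restores it, since reducedness forbids
    another cancellation. Opposite letters thus act on reduced words as inverse permutations, as in
    van der Waerden's argument for free groups. *)
Lemma pushK s g x w : reduced w -> push s g x (push (~~ s) g x w) = w.
Proof.
rewrite {2}/push; case: ifP => [|_ _]; last by rewrite /push /= !eqxx.
case: w => //= s' g' x' w /and3P[/eqP-> /eqP-> /eqP->] /andP[_].
by rewrite negbK /push => /negbTE->.
Qed.

Lemma weq_push n s g x w : weq n.+1 (push s g x w) (Cons s g x w).
Proof.
rewrite /push; case: ifP => _c; last exact: weq_refl.
case: w _c => //= s' g' x' w /and3P[/eqP-> /eqP-> /eqP->].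
by apply: free_sym; exact: free_cancel.
Qed.

Lemma weq_nf n u : weq n (nf n u) u.
Proof.
elim: n u => // n IHn; elim=> [|s g _ x u IHu]; first exact: weq_refl.
apply: weq_trans (weq_push _ _ _ _ _) _.
by apply: free_cons IHu; exact: IHn.
Qed.

Lemma nf_weq n u v : weq n u v -> nf n u = nf n v.
Proof.
elim: n u v => // n IHn u v; elim=> {u v} //.
- by move=> u v w _ -> _ ->.
- by move=> s g h x u v /IHn /= -> _ ->.
- by move=> s g x u; rewrite /= pushK //; exact: (nf_reduced n.+1).
Qed.

Lemma nf_eqP n u v : reflect (weq n u v) (nf n u == nf n v).
Proof.
apply: (iffP eqP) => [e|]; last exact: nf_weq.
by apply: weq_trans (weq_nf n v); rewrite -e; exact/weq_sym/weq_nf.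
Qed.

Lemma nf_id n u : nf n (nf n u) == nf n u.
Proof. exact/nf_eqP/weq_nf. Qed.

Definition opw n := brace_op app inv (bar n) lamw.

Lemma weq_opw m n o u u' v v' :
  weq n u u' -> weq n v v' -> weq n (opw m o u v) (opw m o u' v').
Proof.
have A := @weq_app n; have L := @weq_lamw_same n.
have I := @weq_inv n; have B := @weq_bar m n.
by case: o => /= uu' vv'; auto 10.
Qed.

(** * The skew brace L_n and its solution *)

Section Model.
Variable n : nat.

Definition nword := {w : word | nf n w == w}.

Definition mk (w : word) : nword := exist _ (nf n w) (nf_id n w).

Lemma mk_val (a : nword) : mk (val a) = a.
Proof. by case: a => w e; apply: val_inj; exact/eqP. Qed.

Lemma mk_eq u v : mk u = mk v <-> weq n u v.
Proof.
by split=> [[] /eqP/nf_eqP | /nf_weq e] //; apply: val_inj.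
Qed.

Lemma val_mk u : weq n (val (mk u)) u.
Proof. exact: weq_nf. Qed.

Definition nmul (a b : nword) := mk (app (val a) (val b)).
Definition ninv (a : nword) := mk (inv (val a)).
Definition nbar (a : nword) := mk (bar n (val a)).
Definition nlam (a b : nword) := mk (lamw (val a) (val b)).

Lemma nmulE u v : nmul (mk u) (mk v) = mk (app u v).
Proof. by apply/mk_eq/weq_app; exact: val_mk. Qed.

Lemma ninvE u : ninv (mk u) = mk (inv u).
Proof. by apply/mk_eq/weq_inv; exact: val_mk. Qed.

Lemma nbarE u : nbar (mk u) = mk (bar n u).
Proof. by apply/mk_eq/weq_bar; exact: val_mk. Qed.

Lemma nlamE u v : nlam (mk u) (mk v) = mk (lamw u v).
Proof. by apply/mk_eq/weq_lamw_same; exact: val_mk. Qed.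

Lemma nwordP (P : nword -> Prop) : (forall u, P (mk u)) -> forall a, P a.
Proof. by move=> H a; rewrite -(mk_val a). Qed.

Let nE := (nmulE, ninvE, nbarE, nlamE).

Definition word_brace : brace.
Proof.
refine (@Brace nword (mk Nil) nmul ninv nbar nlam _ _ _ _ _ _ _ _).
- elim/nwordP=> u; elim/nwordP=> v; elim/nwordP=> w.
  by rewrite !nE appA.
- by elim/nwordP=> u; rewrite nE.
- elim/nwordP=> u; rewrite !nE; exact/mk_eq/weq_inv_cat.
- elim/nwordP=> a; elim/nwordP=> u; elim/nwordP=> v.
  by rewrite !nE lamw_app.
- by elim/nwordP=> u; rewrite nE lamw_Nil.
- elim/nwordP=> a; elim/nwordP=> b; elim/nwordP=> u.
  by rewrite !nE lamw_circ.
- elim/nwordP=> u; rewrite !nE; exact/mk_eq/weq_bar_circ.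
- elim/nwordP=> u; rewrite !nE; exact/mk_eq/weq_circ_bar.
Defined.

Definition word_solution : solution := brace_solution word_brace.

Lemma op_val_mk o u v :
  @op_val word_solution o (mk u) (mk v) = mk (opw n o u v).
Proof.
rewrite op_val_brace_solution.
by case: o; rewrite /= ?[@bmul _]/nmul ?[@binv _]/ninv ?[@bbar _]/nbar
  ?[@blam _]/nlam !nE.
Qed.

Fixpoint eval_word (X : Type) (c : X -> nat) (t : term X) : word :=
  match t with
  | Var x => Cons true Nil (c x) Nil
  | App o t1 t2 => opw n o (eval_word c t1) (eval_word c t2)
  end.

Definition gen k : word_solution := mk (Cons true Nil k Nil).

Lemma term_val_word_solution (X : Type) (c : X -> nat) (t : term X) :
  term_val (gen \o c) t = mk (eval_word c t).
Proof. by elim: t => //= o t1 -> t2 ->; rewrite op_val_mk. Qed.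

(** * Right nilpotency of the model, through the projections of L_n onto L_m *)

Definition veq m (a b : nword) := weq m (val a) (val b).

Lemma veq_op m o (x x' y y' : word_solution) :
  m <= n -> veq m x x' -> veq m y y' -> veq m (op_val o x y) (op_val o x' y').
Proof.
move: x x' y y'; elim/nwordP=> x; elim/nwordP=> x'.
elim/nwordP=> y; elim/nwordP=> y' mn.
have nfm u : weq m (nf n u) u by apply: weq_le mn _; exact: weq_nf.
rewrite /veq !op_val_mk /= => xx' yy'.
apply: weq_trans (nfm _) _; apply: weq_trans (weq_sym (nfm _)).
by apply: weq_opw;
  apply: weq_trans (weq_sym (nfm _)) (weq_trans _ (nfm _)).
Qed.

Lemma veq_W m (f : word_solution -> word_solution) a b :
  m <= n -> in_W f -> veq m a b -> veq m (f a) (f b).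
Proof.
move=> mn Wf; elim: Wf a b => {f} //.
- by move=> f g _ IHf _ IHg a b ab; apply: IHf; exact: IHg.
- by move=> [] x a b; [apply: (@veq_op m OpLam) | apply: (@veq_op m OpLamV)];
    rewrite // /veq; exact: weq_refl.
- by move=> [] x a b; [apply: (@veq_op m OpRho) | apply: (@veq_op m OpRhoV)];
    rewrite // /veq; exact: weq_refl.
- by move=> z a b ab; apply: (@veq_op m OpRho); rewrite // /veq; exact: weq_refl.
Qed.

Lemma val_lam_sign a (x z : word_solution) :
  lam_sign a x z = mk (lamw (if a then val x else bar n (val x)) (val z)).
Proof.
rewrite -{1}(mk_val x) -{1}(mk_val z).
by case: a; [exact: (op_val_mk OpLam) | exact: (op_val_mk OpLamV)].
Qed.

Lemma veq_lam_sign m a (x y z : word_solution) :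
  m < n -> veq m x y -> veq m.+1 (lam_sign a x z) (lam_sign a y z).
Proof.
move=> mn xy; rewrite /veq !val_lam_sign.
have nfm u : weq m.+1 (nf n u) u by apply: weq_le mn _; exact: weq_nf.
apply: weq_trans (nfm _) _; apply: weq_trans (weq_sym (nfm _)).
by apply: weq_lamw (weq_refl _ _); case: (a); last exact: weq_bar.
Qed.

Lemma veq1_lam_sign a (x y : word_solution) : 0 < n -> veq 1 (lam_sign a x y) y.
Proof.
move=> n0; rewrite /veq val_lam_sign.
apply: weq_trans (weq_le n0 (weq_nf _ _)) _.
by rewrite -[X in weq _ _ X]lamw_Nil; apply: weq_lamw (weq_refl _ _).
Qed.

(** Each nested lambda gains one level: maps in W respect [veq], and lambda depends on its index one
    level lower. *)
Lemma veq_lam_iter m a b (x y : word_solution) s :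
  m + size s < n -> List.Forall (fun e => in_W e.1.2) s ->
  (forall z, veq m.+1 (lam_sign a x z) (lam_sign b y z)) ->
  forall z, veq (m + size s).+1 (lam_iter a x s z) (lam_iter b y s z).
Proof.
rewrite /lam_iter; move: (lam_sign a x) (lam_sign b y).
elim: s m => [|[[c f] v] s IHs] m p q; first by rewrite addn0.
rewrite /= addnS -addSn => mn /List.Forall_cons_iff[Wf Ws] pq.
have mn' : m.+1 < n := leq_ltn_trans (leq_addr _ _) mn.
apply: IHs => // z; apply: veq_lam_sign => //.
by apply: veq_W => //; exact: ltnW.
Qed.

Lemma veq_eq (x y : word_solution) : veq n x y -> x = y.
Proof. by move=> xy; rewrite -(mk_val x) -(mk_val y); exact/mk_eq. Qed.

Lemma word_solution_RNS : 0 < n -> RNS n word_solution.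
Proof.
suff: forall m, m = n -> 0 < m -> RNS m word_solution by apply.
case=> [|[|k]] // En _.
  move=> x y; apply: veq_eq; rewrite -{1}En.
  by apply: (@veq1_lam_sign true); rewrite -En.
have n1 : 1 < n by rewrite -En.
move=> a1 a2 v1 v2 m2 s sk Wm Ws z; apply: veq_eq.
(* The innermost lambda is trivial at level 1, so dropping it leaves indices equal there. The next
   lambdas agree at level 2, and the k = n - 2 entries of [s] lead to level n. *)
have -> : lam_iter a1 v1 ((a2, m2, v2) :: s) z =
  lam_iter a2 (m2 (lam_sign a1 v1 v2)) s z by [].
rewrite -{1}En -sk -[(size s).+1]/(1 + size s).
apply: veq_lam_iter => //; first by rewrite sk -En.
move=> {}z; apply: veq_lam_sign => //.
by apply: veq_W; [exact: ltnW | | apply: veq1_lam_sign; exact: ltnW].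
Qed.
End Model.

(** * Reading words in an injective right nilpotent solution *)

Section StructureGroup.
Variable K : solution.
Implicit Types (x y z k l : K) (a b u v : seq (bool * K)).
Local Notation sg := (@structure_group_eq K).
Local Notation "[+ k ]" := [:: (true, k)] (at level 0).

Lemma sg_cat a b u v : sg u v -> sg (a ++ u ++ b) (a ++ v ++ b).
Proof.
elim=> {u v}.
- by move=> u; exact: sg_refl.
- by move=> u v _; exact: sg_sym.
- by move=> u v w _ + _; exact: sg_trans.
- by move=> u s x w; have := sg_cancel (a ++ u) s x (w ++ b); rewrite -!catA.
- by move=> u x y w; have := sg_rel (a ++ u) x y (w ++ b); rewrite -!catA.
Qed.

Lemma sg_catl a u v : sg u v -> sg (a ++ u) (a ++ v).
Proof. by move=> /(sg_cat a [::]); rewrite !cats0. Qed.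

Lemma sg_catr b u v : sg u v -> sg (u ++ b) (v ++ b).
Proof. exact: (@sg_cat [::]). Qed.

Definition sinv u := rev [seq (~~ e.1, e.2) | e <- u].

Lemma sinv_cons s x u : sinv ((s, x) :: u) = rcons (sinv u) (~~ s, x).
Proof. by rewrite /sinv /= rev_cons. Qed.

Lemma sg_inv_cat u : sg (sinv u ++ u) [::].
Proof.
elim: u => [|[s x] u IHu]; first exact: sg_refl.
rewrite sinv_cons cat_rcons; apply: sg_trans IHu.
by have := sg_cancel (sinv u) (~~ s) x u; rewrite negbK.
Qed.

Lemma sg_catI a u v : sg (a ++ u) (a ++ v) -> sg u v.
Proof.
move=> /(sg_catl (sinv a)); rewrite !catA => H.
have E w : sg ((sinv a ++ a) ++ w) w := sg_catr w (sg_inv_cat a).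
exact: sg_trans (sg_sym (E u)) (sg_trans H (E v)).
Qed.

Fixpoint act u (z : K) : K :=
  if u is (s, x) :: u then lam_sign s x (act u z) else z.

Fixpoint actV u (z : K) : K :=
  if u is (s, x) :: u then actV u (lam_sign (~~ s) x z) else z.

Lemma lam_signK s x : cancel (lam_sign s x) (lam_sign (~~ s) x).
Proof. by case: s; [exact: lamK | exact: lamVK]. Qed.

Lemma lam_signVK s x : cancel (lam_sign (~~ s) x) (lam_sign s x).
Proof. by case: s; [exact: lamVK | exact: lamK]. Qed.

Lemma actK u : cancel (act u) (actV u).
Proof. by elim: u => [|[s x] u IHu] z //=; rewrite lam_signK. Qed.

Lemma actVK u : cancel (actV u) (act u).
Proof.
by elim: u => [|[s x] u IHu] z //=; rewrite IHu lam_signVK.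
Qed.

Lemma act_cat u v z : act (u ++ v) z = act u (act v z).
Proof. by elim: u => [|[s x] u IHu] //=; rewrite IHu. Qed.

Lemma actV_cat u v z : actV (u ++ v) z = actV v (actV u z).
Proof. by elim: u z => [|[s x] u IHu] z //=; rewrite IHu. Qed.

Lemma actV_sinv u z : actV (sinv u) z = act u z.
Proof.
elim: u => [|[s x] u IHu] //=.
by rewrite sinv_cons -cats1 actV_cat /= negbK IHu.
Qed.

Lemma lam_yb x y z : lam (lam x y) (lam (rho y x) z) = lam x (lam y z).
Proof.
have := yang_baxter (x, y, z); rewrite /comp /r12 /r23 /=.
rewrite /lam /rho.
case: (r (y, z)) => p q; case: (r ((r (x, y)).2, z)) => p' q' /=.
by case: (r ((r (x, p)).2, q)) => p'' q'' [-> _].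
Qed.

Lemma rho_lam_yb x y z :
  rho (lam (rho y x) z) (lam x y) = lam (rho (lam y z) x) (rho z y).
Proof.
have := yang_baxter (x, y, z); rewrite /comp /r12 /r23 /=.
rewrite /lam /rho.
case: (r (y, z)) => p q; case: (r ((r (x, y)).2, z)) => p' q' /=.
by case: (r ((r (x, p)).2, q)) => p'' q'' [-> _].
Qed.

Lemma act_sg u v : sg u v -> act u =1 act v.
Proof.
elim=> {u v} //.
- by move=> u v _ IH z; rewrite IH.
- by move=> u v w _ IH1 _ IH2 z; rewrite IH1.
- by move=> u s x w z; rewrite !act_cat /= lam_signVK.
- by move=> u x y w z; rewrite !act_cat /= lam_yb.
Qed.

Lemma actV_sg u v : sg u v -> actV u =1 actV v.
Proof. by move=> /act_sg uv z; rewrite -{1}(actVK v z) -uv actK. Qed.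

(* Right conjugation by l in the additive structure group: in the structure
   group, k o a = l o b with l = lam k a, and aconj l k = lam l b. *)
Definition aconj l k : K := lam l (rho (lamV k l) k).

(** Lambda acts by automorphisms of the additive structure group; in K itself this follows from
    [lam_yb] and [rho_lam_yb]. *)
Lemma lam_aconj x l k : lam x (aconj l k) = aconj (lam x l) (lam x k).
Proof.
rewrite /aconj; set v := lamV k l.
have kv : lam k v = l by rewrite lamVK.
have e : lam (lam x k) (lam (rho k x) v) = lam x l by rewrite lam_yb kv.
by rewrite -e lamK e rho_lam_yb kv lam_yb.
Qed.

Lemma lamV_aconj x l k : lamV x (aconj l k) = aconj (lamV x l) (lamV x k).
Proof. by apply: (can_inj (lamK x)); rewrite lam_aconj !lamVK. Qed.

Lemma actV_aconj u l k : actV u (aconj l k) = aconj (actV u l) (actV u k).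
Proof.
elim: u l k => [|[[] x] u IHu] l k //=; rewrite -IHu.
- by rewrite lamV_aconj.
- by rewrite lam_aconj.
Qed.

Lemma aconj_inj l : injective (aconj l).
Proof.
move=> k k' /(can_inj (lamK l)) e.
have E m : r (m, lamV m l) = (l, rho (lamV m l) m).
  by rewrite [LHS]surjective_pairing -[(r _).1]/(lam _ _) lamVK.
have : (k, lamV k l) = (k', lamV k' l).
  by apply: (can_inj (@rK K)); rewrite !E e.
by case.
Qed.

Definition aconjV l k : K := (rV (l, lamV l k)).1.

Lemma aconjVK l k : aconj l (aconjV l k) = k.
Proof.
rewrite /aconj /aconjV; case E: (rV (l, lamV l k)) => [m v] /=.
have := rVK (l, lamV l k); rewrite E => rE.
have e1 : lam m v = l by rewrite /lam rE.
by rewrite -e1 lamK /rho rE /= e1 lamVK.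
Qed.

Lemma aconjV_eq l k m : aconj l m = k -> m = aconjV l k.
Proof. by move=> <-; apply: (@aconj_inj l); rewrite aconjVK. Qed.

Hypothesis injK : injective_solution K.

(** The defining relation for [k] and [lamV k k] has [k] as first letter on both sides, which
    cancels. With [lam_rhoV_diag], obtained by cancelling on the right, it makes opposite letters
    cancel in readings. *)
Lemma rho_lamV_diag k : rho (lamV k k) k = lamV k k.
Proof.
apply: injK; apply: (@sg_catI [+ k]).
by have /sg_sym := sg_rel [::] k (lamV k k) [::]; rewrite lamVK.
Qed.

Lemma rhoV_lamV_diag k : rhoV (lamV k k) (lamV k k) = k.
Proof. by rewrite -{2}rho_lamV_diag rhoK. Qed.

Lemma lam_rhoV_diag k : lam (rhoV k k) k = rhoV k k.
Proof.
apply: injK; have := sg_rel [::] (rhoV k k) k [::]; rewrite rhoVK /=.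
set x := rhoV k k => H.
have {H} := sg_catr [:: (false, k)] H => /= H.
apply: sg_sym; apply: sg_trans (sg_sym _) (sg_trans H _).
- exact: (sg_cancel [+ x] true k [::]).
- exact: (sg_cancel [+ lam x k] true k [::]).
Qed.

(* The letter k^{+1} or k^{-1} of the additive structure group, read after the
   word b of the structure group: the inverse of k for the addition is the
   inverse of [rhoV k k] in the structure group. *)
Definition letter b s k : bool * K :=
  let k' := actV b k in if s then (true, k') else (false, rhoV k' k').

Variable g : nat -> K.

(** A product a * k in a skew brace is a o lambda_a^-1 (k), so each letter is pulled back along the
    word [b] read so far. *)
Fixpoint Phi (w : word) b : seq (bool * K) :=
  if w is Cons s h x w then
    Phi w (rcons b (letter b s (act (Phi h [::]) (g x))))
  else b.

Lemma Phi_app (u v : word) b : Phi (app u v) b = Phi v (Phi u b).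
Proof. by elim: u b => //= s h _ x u IHu b; rewrite IHu. Qed.

Lemma letter_act b c a s k :
  (forall z, actV c z = actV b (act a z)) -> letter b s (act a k) = letter c s k.
Proof. by move=> H; rewrite /letter H. Qed.

(** Letters depend on the accumulator only through its action, so translating them by [p] can be
    traded for a change of accumulator. *)
Lemma Phi_lamw p w b c :
  (forall z, actV c z = actV b (act (Phi p [::]) z)) ->
  exists v, Phi (lamw p w) b = b ++ v /\ Phi w c = c ++ v.
Proof.
elim: w b c => [|s h IHh x w IHw] b c H /=.
  by exists [::]; rewrite !cats0.
(* On the inner word: p o h is read as the reading of p followed by that of h. *)
have [v [e1 e2]] := IHh (Phi p [::]) [::] (fun z => esym (actK _ _)).
rewrite Phi_app e1 e2 act_cat /= (letter_act _ _ H).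
set e := letter _ _ _.
have {}H z : actV (rcons c e) z = actV (rcons b e) (act (Phi p [::]) z).
  by rewrite -!cats1 !actV_cat H.
have [v' [-> ->]] := IHw _ _ H.
by exists (e :: v'); rewrite !cat_rcons.
Qed.

Lemma letter_cancel b s k :
  letter (rcons b (letter b s k)) (~~ s) k = (~~ s, (letter b s k).2).
Proof.
rewrite /letter -cats1 actV_cat; case: s => /=.
- by rewrite rhoV_lamV_diag.
- by rewrite lam_rhoV_diag.
Qed.


Section PhiCompat.
Variables (R : word -> word -> Prop) (E : seq (bool * K) -> seq (bool * K) -> Prop).
Hypotheses (Erefl : forall b, E b b) (Esym : forall b c, E b c -> E c b).
Hypothesis Etrans : forall a b c, E a b -> E b c -> E a c.
Hypothesis Ecancel : forall b s k, E (b ++ [:: (s, k); (~~ s, k)]) b.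
Hypothesis Eletter : forall b c s h h' (x : nat), E b c -> R h h' ->
  E (rcons b (letter b s (act (Phi h [::]) (g x))))
    (rcons c (letter c s (act (Phi h' [::]) (g x)))).
Hypothesis Rrefl : forall h, R h h.

Lemma Phi_compat_acc (w : word) b c : E b c -> E (Phi w b) (Phi w c).
Proof.
elim: w b c => //= s h _ x w IHw b c bc; apply: IHw.
exact: Eletter.
Qed.

(** Abstract in [R] and [E] because it serves twice: for actions modulo [req], then for equality in
    the structure group. *)
Lemma Phi_compat (u v : word) b c : free_eq R u v -> E b c -> E (Phi u b) (Phi v c).
Proof.
move=> uv; elim: uv b c => {u v}.
- by move=> u b c; exact: Phi_compat_acc.
- by move=> u v _ IH b c /Esym/IH/Esym.
- by move=> u v w _ IHu _ IHv b c /IHu uv; apply: Etrans (uv) (IHv _ _ _).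
- by move=> s h h' x u v hh' _ IH b c bc; apply: IH; exact: Eletter.
- move=> s h x u b c bc /=; apply: Phi_compat_acc; apply: Etrans bc.
  rewrite letter_cancel -!cats1 -catA /=.
  suff -> e : letter b s e = (s, (letter b s e).2) by exact: Ecancel.
  by rewrite /letter; case: (s).
Qed.
End PhiCompat.

(* req j is the congruence whose quotient is the j-th iterated retraction. *)
Fixpoint req j x y : Prop :=
  if j is j.+1 then
    forall s m z, in_W m -> req j (lam_sign s (m x) z) (lam_sign s (m y) z)
  else x = y.

Lemma req_refl j x : req j x x.
Proof. by elim: j x => //= j IHj *. Qed.

Lemma req_sym j x y : req j x y -> req j y x.
Proof. by elim: j x y => //= j IHj x y xy s m z /xy/IHj. Qed.

Lemma req_trans j x y z : req j x y -> req j y z -> req j x z.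
Proof.
elim: j x y z => [|j IHj] x y z /=; first by move=> ->.
by move=> xy yz s m t Wm; apply: IHj (xy _ _ _ Wm) (yz _ _ _ Wm).
Qed.

Lemma req_W j m x y : in_W m -> req j x y -> req j (m x) (m y).
Proof.
case: j => [|j] Wm /=; first by move=> ->.
by move=> xy s m' z Wm'; apply: (xy s (m' \o m)); exact: W_comp.
Qed.

Lemma req_lam_sign j s x y z :
  req j.+1 x y -> req j (lam_sign s x z) (lam_sign s y z).
Proof. by move=> xy; apply: (xy s id); exact: W_id. Qed.

Lemma reqS j x y : req j x y -> req j.+1 x y.
Proof.
elim: j x y => [|j IHj] x y; first by move=> -> *.
by move=> xy s m z Wm; apply: IHj; exact: xy.
Qed.

Lemma req_rhoV j x y : req j x y -> req j (rhoV x x) (rhoV y y).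
Proof.
move=> xy; apply: (@req_trans _ _ (rhoV x y)).
  exact: req_W (W_rho false x) xy.
(* With z = [rhoV y y], D_z sends x and y to [rho x z] and y; [rhoV x] then sends these to z and
   [rhoV x y]. *)
have := req_W (W_rho false x) (req_W (W_D (rhoV y y)) xy).
by rewrite /= rhoK rhoVK; exact: req_sym.
Qed.

Lemma act_W u : in_W (act u).
Proof.
elim: u => [|[s x] u IHu]; first exact: W_id.
exact: W_comp (W_lam s x) IHu.
Qed.

Lemma actV_W u : in_W (actV u).
Proof.
elim: u => [|[s x] u IHu]; first exact: W_id.
exact: W_comp IHu (W_lam (~~ s) x).
Qed.

Definition act_eq j b c := forall z, req j (act b z) (act c z).

Lemma act_eq_actV j b c z : act_eq j b c -> req j (actV b z) (actV c z).
Proof.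
move=> bc; rewrite -{2}(actVK b z); apply: req_sym.
have := req_W (actV_W c) (bc (actV b z)).
by rewrite actK.
Qed.

Lemma act_eq_rcons j b c s k l :
  act_eq j b c -> req j.+1 k l ->
  act_eq j (rcons b (letter b s k)) (rcons c (letter c s l)).
Proof.
move=> bc kl z; rewrite -!cats1 !act_cat.
have bcV : req j.+1 (actV b k) (actV c l).
  apply: req_trans (reqS (act_eq_actV k bc)) _.
  exact: req_W (actV_W c) kl.
apply: req_trans (bc _) _; apply: req_W (act_W c) _.
rewrite /letter; case: s => /=.
- exact: (@req_lam_sign j true).
- exact/(@req_lam_sign j false)/req_rhoV.
Qed.

(** * Readings respect equality in L_(n+1) when K is in RNS_(n+1) *)

Section Nilpotent.
Variable n : nat.
Hypothesis nilK : RNS n.+1 K.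

Lemma lam_iter_req i s t x y :
  (forall (l : seq (bool * (K -> K) * K)), size l = i ->
     List.Forall (fun e => in_W e.1.2) l -> forall m, in_W m ->
     lam_iter s (m x) l =1 lam_iter t (m y) l) ->
  forall m z, in_W m -> req i (lam_sign s (m x) z) (lam_sign t (m y) z).
Proof.
elim: i s t x y => [|i IHi] s t x y H m z Wm.
  exact: (H [::]).
move=> s' m' z' Wm'; apply: (IHi _ _ _ _ _ m') => // l sl Wl p Wp.
apply: (H ((s', p, z) :: l)) => //=; first by rewrite sl.
by apply/List.Forall_cons.
Qed.

(** The form in which nilpotency is used: class at most n + 1 makes lambda trivial on the n-th
    iterated retraction. *)
Lemma req_lam s x z : req n (lam_sign s x z) z.
Proof.
move: nilK; case: (n) => [|i] /= H.
  by case: s => /=; [exact: H | apply: (can_inj (lamK x)); rewrite lamVK H].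
move=> s' m z' Wm; apply: (@lam_iter_req i) => // l sl Wl p Wp.
exact: (H s s' x z p l).
Qed.

(** Levels of nesting are traded for retractions: modulo [req n] every action is trivial, and each
    level undoes one retraction by [act_eq_rcons]. For j = n the actions agree exactly. *)
Lemma Phi_weq_lower j (u v : word) b c :
  j <= n -> weq j u v -> act_eq (n - j) b c -> act_eq (n - j) (Phi u b) (Phi v c).
Proof.
elim: j u v b c => [|j IHj] u v b c jn.
  move=> _ _ z; have H a : req n (act a z) z.
    elim: a => [|[s x] a IHa]; first exact: req_refl.
    exact: req_trans (req_lam s x _) IHa.
  by rewrite subn0; exact: req_trans (H _) (req_sym (H _)).
have nj : n - j = (n - j.+1).+1 by rewrite subnSK.
move: (n - j.+1) nj => i nj.
apply: (@Phi_compat (weq j)).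
- by move=> a z; exact: req_refl.
- by move=> a a' H z; exact/req_sym/H.
- by move=> a a' a'' H H' z; exact: req_trans (H z) (H' z).
- move=> a s k z; rewrite act_cat /= lam_signVK; exact: req_refl.
- move=> a a' s h h' x H hh'; apply: act_eq_rcons => //; rewrite -nj.
  by apply: IHj hh' _ _; [exact: ltnW | move=> ?; exact: req_refl].
- exact: weq_refl.
Qed.

Lemma sg_letter b c s k :
  sg b c -> sg (rcons b (letter b s k)) (rcons c (letter c s k)).
Proof.
move=> bc; rewrite -!cats1 /letter (actV_sg bc); exact: sg_catr.
Qed.

Lemma Phi_weq (u v : word) b : weq n.+1 u v -> sg (Phi u b) (Phi v b).
Proof.
move=> uv; apply: (@Phi_compat (weq n)) uv (sg_refl b).
- exact: sg_refl.
- by move=> a a'; exact: sg_sym.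
- by move=> a a' a''; exact: sg_trans.
- by move=> a s k; have := sg_cancel a s k [::]; rewrite !cats0.
- move=> a a' s h h' x H hh'.
  have -> : act (Phi h' [::]) (g x) = act (Phi h [::]) (g x).
    have := @Phi_weq_lower n h' h [::] [::] (leqnn _) (weq_sym hh').
    by rewrite subnn; apply; move=> z.
  exact: sg_letter.
- exact: weq_refl.
Qed.

Lemma Phi_sg w b c : sg b c -> sg (Phi w b) (Phi w c).
Proof.
elim: w b c => //= s h _ x w IHw b c bc; apply: IHw; exact: sg_letter.
Qed.

(* The word u represents k, and so does each of its translates: reading u after
   b amounts to multiplying b by the pullback of k along b. *)
Definition represents (u : word) k :=
  forall b, sg (Phi u b) (rcons b (true, actV b k)).

Lemma represents_weq (u v : word) k :
  weq n.+1 u v -> represents u k -> represents v k.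
Proof. by move=> /weq_sym uv uk b; apply: sg_trans (Phi_weq b uv) (uk b). Qed.

Lemma represents_inj (u : word) k l : represents u k -> represents u l -> k = l.
Proof.
by move=> /(_ [::]) /sg_sym uk /(_ [::]) ul; apply: injK; exact: sg_trans uk ul.
Qed.

Lemma represents_var (x : nat) : represents (Cons true Nil x Nil) (g x).
Proof. by move=> b; exact: sg_refl. Qed.

Lemma represents_lamw p (u : word) k :
  represents u k -> represents (lamw p u) (act (Phi p [::]) k).
Proof.
move=> uk b; set a := Phi p [::].
have H z : actV (sinv a ++ b) z = actV b (act a z).
  by rewrite actV_cat actV_sinv.
have [v [-> e]] := @Phi_lamw p u b _ H.
rewrite -cats1; apply: sg_catl.
by apply: (@sg_catI (sinv a ++ b)); rewrite -e -H cats1; exact: uk.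
Qed.

Lemma act_represents (u : word) k z : represents u k -> act (Phi u [::]) z = lam k z.
Proof. by move=> /(_ [::])/act_sg->. Qed.

Lemma represents_lam (u v : word) k l :
  represents u k -> represents v l -> represents (lamw u v) (lam k l).
Proof.
by move=> uk /(represents_lamw u); rewrite (act_represents _ uk).
Qed.

Lemma Phi_circ (u v : word) : Phi (app u (lamw u v)) [::] = Phi u [::] ++ Phi v [::].
Proof.
rewrite Phi_app.
by have [w [-> ->]] := @Phi_lamw u v _ [::] (fun z => esym (actK _ _)).
Qed.

Lemma represents_lamV (u v : word) k l :
  represents u k -> represents v l -> represents (lamw (bar n.+1 u) v) (lamV k l).
Proof.
move=> uk /(represents_lamw (bar n.+1 u)).
suff -> : act (Phi (bar n.+1 u) [::]) l = lamV k l by [].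
apply: (can_inj (lamK k)); rewrite lamVK -(act_represents _ uk) -act_cat.
by rewrite -Phi_circ (act_sg (Phi_weq _ (weq_circ_bar _ _))).
Qed.

Lemma actV_rcons b k z : actV (rcons b (true, k)) z = lamV k (actV b z).
Proof. by rewrite -cats1 actV_cat. Qed.

Lemma sg_rcons_rel b k l :
  sg (rcons (rcons b (true, k)) (true, lamV k l))
     (rcons (rcons b (true, l)) (true, rho (lamV k l) k)).
Proof.
by have := sg_rel b k (lamV k l) [::]; rewrite lamVK -!cats1 -!catA.
Qed.

Lemma sg_rcons e b c : sg b c -> sg (rcons b e) (rcons c e).
Proof. by rewrite -!cats1; exact: sg_catr. Qed.

(** After [inv v], the defining relation exchanges the readings of k and l, so that l comes first
    and cancels [inv v]. *)
Lemma represents_aconj (u v : word) k l :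
  represents u k -> represents v l ->
  represents (app (inv v) (app u v)) (aconj l k).
Proof.
move=> uk vl b; rewrite !Phi_app; set c := Phi (inv v) b.
have bc : sg b (rcons c (true, actV c l)).
  apply: sg_trans (vl c); rewrite -Phi_app; apply: sg_sym.
  exact: Phi_weq (weq_inv_cat _ _).
apply: sg_trans (Phi_sg v (uk c)) _; apply: sg_trans (vl _) _.
rewrite actV_rcons; apply: sg_trans (sg_rcons_rel _ _ _) _.
apply: sg_trans (sg_rcons _ (sg_sym bc)) _.
rewrite (actV_sg bc) actV_rcons actV_aconj lamK; exact: sg_refl.
Qed.

(** By the defining relation, reading k after l amounts to reading l after [aconjV l k]; [inv v]
    then removes l. *)
Lemma represents_aconjV (u v : word) k l :
  represents u k -> represents v l ->
  represents (app v (app u (inv v))) (aconjV l k).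
Proof.
move=> uk vl b; rewrite !Phi_app; set m := aconjV l k.
set c := rcons b (true, actV b m).
apply: (@sg_trans _ _ (Phi (inv v) (Phi v c))); last first.
  by rewrite -Phi_app; exact: Phi_weq (weq_cat_inv _ _).
apply: Phi_sg; apply: sg_trans (Phi_sg u (vl b)) _.
apply: sg_trans (uk _) _; apply: sg_sym; apply: sg_trans (vl _) _.
rewrite !actV_rcons; apply: sg_trans (sg_rcons_rel _ _ _) _.
rewrite -(aconjVK l k) -/m actV_aconj lamK; exact: sg_refl.
Qed.

Lemma represents_bar_inv (u : word) k :
  represents u k -> represents (bar n.+1 (inv u)) (rhoV k k).
Proof.
set z := bar _ _; move=> uk.
(* As [z] is the circle inverse of [inv u], z * lambda_z (inv u) = 1, that is z = lambda_z u in
   L_(n+1). *)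
have zk : represents z (act (Phi z [::]) k).
  apply: represents_weq (represents_lamw z uk); apply: weq_sym.
  have := weq_app (weq_bar_circ n.+1 (inv u)) (weq_refl n.+1 (lamw z u)).
  rewrite -/z lamw_inv -appA; apply: weq_trans.
  rewrite -{1}[z]appN; apply: weq_app (weq_refl _ _) _.
  exact/weq_sym/weq_inv_cat.
have := act_represents k zk; set m := act _ k in zk * => e.
have -> : k = lamV m m by rewrite {2}e lamK.
by rewrite rhoV_lamV_diag.
Qed.

(** Brings [rhoV] to the shape of the [OpRhoV] formula of [brace_op], so that [represents_bar_inv]
    applies. *)
Lemma rhoV_aconjV k l :
  rhoV k l = let m := aconjV k (lam k (lamV l l)) in rhoV m m.
Proof.
set z := rhoV k l; have -> : l = rho k z by rewrite rhoVK.
have <- : lamV z z = aconjV k (lam k (lamV (rho k z) (rho k z))).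
  apply: aconjV_eq; apply: (can_inj (lamK z)).
  by rewrite lam_aconj lamVK -lam_yb lamVK /aconj lamK.
by rewrite /= rhoV_lamV_diag.
Qed.

Lemma represents_opw o (u v : word) k l :
  represents u k -> represents v l ->
  represents (opw n.+1 o u v) (op_val o k l).
Proof.
move=> uk vl; have aV : represents (opw n.+1 OpRV1 u v) (rV (k, l)).1.
  rewrite -[l in (k, l)](lamK k) -/(aconjV k (lam k l)).
  exact: represents_aconjV (represents_lam uk vl) uk.
case: o => //.
- exact: represents_lam.
- exact: represents_lamV.
- have := represents_lam vl uk => lk.
  have := represents_lamV lk (represents_aconj vl lk).
  by rewrite /aconj !lamK.
- rewrite /= rhoV_aconjV; apply: represents_bar_inv.
  by apply: represents_aconjV (uk); apply: represents_lam (uk) _;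
    exact: represents_lamV.
- have := represents_lamV aV uk.
  rewrite /=; case: (rV (k, l)) (rVK (k, l)) => z w e.
  by rewrite -{2}(lamK z w) /lam e.
Qed.

Lemma represents_eval_word (X : Type) (c : X -> nat) (i : X -> K) (t : term X) :
  (forall x : X, occurs x t -> g (c x) = i x) ->
  represents (eval_word n.+1 c t) (term_val i t).
Proof.
elim: t => [x|o t1 IH1 t2 IH2] H /=.
  by rewrite -H //; exact: represents_var.
by apply: represents_opw; [apply: IH1 | apply: IH2] => x Hx; apply: H;
  [left | right].
Qed.
End Nilpotent.
End StructureGroup.

(** * Programs *)

Lemma tree_comparable : comparable tree.
Proof. by move=> t u; rewrite /decidable; decide equality. Qed.
HB.instance Definition _ := hasDecEq.Build tree (compareP tree_comparable).

Definition computable (f : tree -> tree) :=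
  exists p, forall t, exec p t (f t).

Lemma computable_id : computable (fun t => t).
Proof. by exists PId => t; exact: ex_id. Qed.

Lemma computable_comp f g :
  computable f -> computable g -> computable (fun t => f (g t)).
Proof. by move=> [p Hp] [q Hq]; exists (PComp p q) => t; exact: ex_comp. Qed.

Lemma computable_fst f : computable f -> computable (fun t => tfst (f t)).
Proof. by apply: computable_comp; exists PFst => t; exact: ex_fst. Qed.

Lemma computable_snd f : computable f -> computable (fun t => tsnd (f t)).
Proof. by apply: computable_comp; exists PSnd => t; exact: ex_snd. Qed.

Lemma computable_Node f g :
  computable f -> computable g -> computable (fun t => Node (f t) (g t)).
Proof. by move=> [p Hp] [q Hq]; exists (PPair p q) => t; exact: ex_pair. Qed.

Lemma computable_Leaf : computable (fun=> Leaf).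
Proof. by exists PLeaf => t; exact: ex_leaf. Qed.

Fixpoint trec (f g : tree -> tree) (a t : tree) : tree :=
  if t is Node t1 t2 then
    g (Node a (Node t (Node (trec f g a t1) (trec f g a t2))))
  else f a.

Lemma computable_trec f g a b :
  computable f -> computable g -> computable a -> computable b ->
  computable (fun t => trec f g (a t) (b t)).
Proof.
move=> [p Hp] [q Hq] ca cb.
suff H : computable (fun t => if t is Node u v then trec f g u v else Leaf).
  exact: computable_comp H (computable_Node ca cb).
exists (PRec p q) => -[|u v]; first exact: ex_rec_none.
elim: v => [|v1 IH1 v2 IH2]; first exact: ex_rec_leaf.
exact: ex_rec_node IH1 IH2 (Hq _).
Qed.

Definition tif (b t u : tree) : tree := if b is Leaf then u else t.

Lemma computable_tif b f g :
  computable b -> computable f -> computable g ->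
  computable (fun t => tif (b t) (f t) (g t)).
Proof.
move=> cb cf cg.
have [p Hp] := computable_trec cg
  (computable_comp cf (computable_fst computable_id)) computable_id cb.
by exists p => t; move: (Hp t); case: (b t).
Qed.

Create HintDb computable.
#[local] Hint Resolve computable_id computable_fst computable_snd : computable.
#[local] Hint Resolve computable_Node computable_Leaf : computable.
#[local] Hint Resolve computable_trec computable_tif : computable.

Ltac computable := auto 50 with computable nocore.

Definition ttrue := Node Leaf Leaf.
Definition teq (t u : tree) : tree := tif (code_bool (t == u)) ttrue Leaf.

(* The loop runs on a list of pairs of trees that remain to be compared; it
   ends in the state Leaf or, after a mismatch, in the state ttrue. *)
Definition teq_step (z : tree) : tree :=
  let t := tfst (tfst z) in let u := tsnd (tfst z) in
  tif t
    (tif u (Node (Node (tfst t) (tfst u)) (Node (Node (tsnd t) (tsnd u)) (tsnd z)))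
       ttrue)
    (tif u ttrue (tsnd z)).

Lemma computable_teq_step : computable teq_step.
Proof. rewrite /teq_step /ttrue; computable. Qed.

(** Continuation form: the outcome on the rest [l] is a hypothesis, so the induction on left
    subtrees can leave the right ones on the list. *)
Lemma teq_loop p t u l z :
  (forall t, exec p t (teq_step t)) ->
  (t = u -> exec (PWhile PFst p) l z) -> (t <> u -> z = ttrue) ->
  exec (PWhile PFst p) (Node (Node t u) l) z.
Proof.
move=> Hp; have fail : exec (PWhile PFst p) ttrue ttrue.
  by apply: ex_while_stop; exact: ex_fst.
have step t' u' l' z' : exec (PWhile PFst p) (teq_step (Node (Node t' u') l')) z' ->
    exec (PWhile PFst p) (Node (Node t' u') l') z'.
  by apply: ex_while_step (Hp _); exact: ex_fst.
elim: t u l => [|t1 IH1 t2 IH2] [|u1 u2] l Heq Hne; apply: step.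
- exact: Heq.
- by rewrite Hne.
- by rewrite Hne.
apply: IH1 => [e1|ne]; last by apply: Hne => -[/ne].
apply: IH2 => [e2|ne]; last by apply: Hne => -[_ /ne].
by apply: Heq; rewrite e1 e2.
Qed.

Lemma computable_teq f g :
  computable f -> computable g -> computable (fun t => teq (f t) (g t)).
Proof.
have [p Hp] := computable_teq_step.
have ceq : computable (fun z =>
    if tfst z == tsnd z then Leaf else ttrue).
  exists (PComp (PWhile PFst p) (PPair (PPair PFst PSnd) PLeaf)) => t.
  apply: (@ex_comp _ _ _ (Node (Node (tfst t) (tsnd t)) Leaf)).
    by do !constructor.
  apply: teq_loop => // [/eqP->|/eqP/negbTE->] //.
  by apply: ex_while_stop; exact: ex_fst.
move=> cf cg.
have [|q Hq] := @computable_tif _ (fun=> Leaf) (fun=> ttrue)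
  (computable_comp ceq (computable_Node cf cg)) computable_Leaf.
  by rewrite /ttrue; computable.
by exists q => t; move: (Hq t); rewrite /teq /=; case: eqP.
Qed.
#[local] Hint Resolve computable_teq : computable.

(* A recursion whose step has access not only to the values y1 and y2 at the
   two subtrees, but also to those at the subtrees of these. *)
Definition dstep (h : tree -> tree) (z : tree) : tree :=
  let y := tsnd (tsnd z) in
  Node (h z) (Node (tfst (tfst y)) (tfst (tsnd y))).

Definition dval f h a t := trec (fun a => Node (f a) Leaf) (dstep h) a t.

Definition drec f h a t := tfst (dval f h a t).

Lemma computable_drec f h a b :
  computable f -> computable h -> computable a -> computable b ->
  computable (fun t => drec f h (a t) (b t)).
Proof.
move=> cf ch ca cb; rewrite /drec /dval; apply: computable_fst.
by apply: computable_trec => //; [ | rewrite /dstep]; computable.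
Qed.
#[local] Hint Resolve computable_drec : computable.

Lemma drec_Node f h a t1 t2 :
  drec f h a (Node t1 t2) =
  h (Node a (Node (Node t1 t2) (Node (dval f h a t1) (dval f h a t2)))).
Proof. by []. Qed.

Lemma dval_Node f h a t1 t2 :
  dval f h a (Node t1 t2) =
  Node (drec f h a (Node t1 t2)) (Node (drec f h a t1) (drec f h a t2)).
Proof. by []. Qed.

(** * Words coded as trees and programs for their operations *)

Fixpoint code_word (w : word) : tree :=
  if w is Cons s g x w then
    Node (Node (Node (code_bool s) (code_nat x)) (code_word g)) (code_word w)
  else Leaf.

Lemma code_nat_inj : injective code_nat.
Proof. by elim=> [|k IHk] [|l] //= [/IHk->]. Qed.

Lemma code_bool_inj : injective code_bool.
Proof. by case=> [] []. Qed.

Lemma code_word_inj : injective code_word.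
Proof.
elim=> [|s g IHg x w IHw] [|s' g' x' w'] //=.
by case=> /code_bool_inj-> /code_nat_inj-> /IHg-> /IHw->.
Qed.

Section WordRec.
Variables (f h : tree -> tree) (a : tree) (F : word -> word).
Hypothesis fE : f a = code_word (F Nil).
Hypothesis hE : forall s g x w t y,
  t = code_word (Cons s g x w) ->
  tsnd (tsnd (tfst y)) = code_word (F g) -> tfst (tsnd y) = code_word (F w) ->
  h (Node a (Node t y)) = code_word (F (Cons s g x w)).

(** The code of the inner word is a grandchild of that of the whole word, which is why [drec] rather
    than [trec] is needed. *)
Lemma drec_word w : drec f h a (code_word w) = code_word (F w).
Proof.
elim: w => [|s g IHg x w IHw]; first exact: fE.
by rewrite [code_word _]/= drec_Node; apply: hE => //; rewrite dval_Node.
Qed.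
End WordRec.

Definition tapp t u :=
  drec id (fun z => Node (tfst (tfst (tsnd z))) (tfst (tsnd (tsnd (tsnd z))))) u t.

Lemma computable_tapp f g :
  computable f -> computable g -> computable (fun t => tapp (f t) (g t)).
Proof. by move=> cf cg; rewrite /tapp; computable. Qed.
#[local] Hint Resolve computable_tapp : computable.

Lemma tappE u v : tapp (code_word u) (code_word v) = code_word (app u v).
Proof. by apply: (drec_word (F := app^~ v)) => // s g x w t y -> _ /= ->. Qed.

Definition tflip l :=
  Node (Node (tif (tfst (tfst l)) Leaf ttrue) (tsnd (tfst l))) (tsnd l).

Definition tinv t :=
  drec (fun=> Leaf) (fun z =>
    tapp (tfst (tsnd (tsnd (tsnd z)))) (Node (tflip (tfst (tfst (tsnd z)))) Leaf))
    Leaf t.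

Lemma computable_tinv f : computable f -> computable (fun t => tinv (f t)).
Proof. by move=> cf; rewrite /tinv /tflip /ttrue; computable. Qed.
#[local] Hint Resolve computable_tinv : computable.

Lemma tflipE s c t :
  tflip (Node (Node (code_bool s) c) t) = Node (Node (code_bool (~~ s)) c) t.
Proof. by case: s. Qed.

Lemma tinvE u : tinv (code_word u) = code_word (inv u).
Proof.
apply: drec_word => // s g x w t y -> _ /= ->.
by rewrite tflipE -[Node _ Leaf]/(code_word (Cons _ g x Nil)) tappE.
Qed.

Definition tlam t u :=
  drec (fun=> Leaf) (fun z =>
    let y := tsnd (tsnd z) in
    Node (Node (tfst (tfst (tfst (tsnd z)))) (tapp (tfst z) (tsnd (tsnd (tfst y)))))
      (tfst (tsnd y))) t u.

Lemma computable_tlam f g :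
  computable f -> computable g -> computable (fun t => tlam (f t) (g t)).
Proof. by move=> cf cg; rewrite /tlam; computable. Qed.
#[local] Hint Resolve computable_tlam : computable.

Lemma tlamE u v : tlam (code_word u) (code_word v) = code_word (lamw u v).
Proof.
by apply: drec_word => // s g x w t y -> /= -> ->; rewrite tappE.
Qed.

(** The level n is fixed: this recursion unfolds while the program is built, not while it runs. The
    same holds for [tnf]. *)
Fixpoint tbar n t := if n is n.+1 then tlam (tbar n t) (tinv t) else Leaf.

Lemma computable_tbar n f : computable f -> computable (fun t => tbar n (f t)).
Proof. by move=> cf; elim: n => /= [|n IHn]; computable. Qed.
#[local] Hint Resolve computable_tbar : computable.

Lemma tbarE n u : tbar n (code_word u) = code_word (bar n u).
Proof. by elim: n => //= n ->; rewrite tinvE tlamE. Qed.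

(** On the empty word [tfst] yields [Leaf], which codes no letter, so the test fails as it
    should. *)
Definition tpush l t := tif (teq (tfst t) (tflip l)) (tsnd t) (Node l t).

Lemma computable_tpush f g :
  computable f -> computable g -> computable (fun t => tpush (f t) (g t)).
Proof. by move=> cf cg; rewrite /tpush /tflip /ttrue; computable. Qed.
#[local] Hint Resolve computable_tpush : computable.

Lemma tpushE s g x w :
  tpush (Node (Node (code_bool s) (code_nat x)) (code_word g)) (code_word w) =
  code_word (push s g x w).
Proof.
rewrite /tpush tflipE /push /teq; case: w => [|s' g' x' w] /=.
  by case: eqP.
set b := _ == _.
suff -> : [&& s' == ~~ s, g' == g & x' == x] = b by case: b.
apply/and3P/eqP => [[/eqP-> /eqP-> /eqP->] //|].
by case=> /code_bool_inj-> /code_nat_inj-> /code_word_inj->; rewrite !eqxx.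
Qed.

Fixpoint tnf n t :=
  if n is n.+1 then
    drec (fun=> Leaf) (fun z =>
      tpush (Node (tfst (tfst (tfst (tsnd z))))
                  (tnf n (tsnd (tfst (tfst (tsnd z))))))
        (tfst (tsnd (tsnd (tsnd z))))) Leaf t
  else Leaf.

Lemma computable_tnf n f : computable f -> computable (fun t => tnf n (f t)).
Proof.
elim: n f => /= [|n IHn] f cf; first by computable.
apply: computable_drec; computable.
Qed.
#[local] Hint Resolve computable_tnf : computable.

Lemma tnfE n u : tnf n (code_word u) = code_word (nf n u).
Proof.
elim: n u => //= n IHn u; apply: drec_word => // s g x w t y -> _ /= ->.
by rewrite IHn tpushE.
Qed.

Definition topw n := brace_op tapp tinv (tbar n) tlam.

Lemma computable_topw n o f g :
  computable f -> computable g -> computable (fun t => topw n o (f t) (g t)).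
Proof. by move=> cf cg; rewrite /topw; case: o => /=; computable. Qed.
#[local] Hint Resolve computable_topw : computable.

Lemma topwE n o u v :
  topw n o (code_word u) (code_word v) = code_word (opw n o u v).
Proof. by case: o => /=; rewrite !(tlamE, tbarE, tinvE, tappE). Qed.

Definition tdispatch n o t u :=
  tif o (tif (tsnd o) (tif (tsnd (tsnd o)) (tif (tsnd (tsnd (tsnd o)))
    (tif (tsnd (tsnd (tsnd (tsnd o)))) (topw n OpRV2 t u) (topw n OpRV1 t u))
    (topw n OpRhoV t u)) (topw n OpRho t u)) (topw n OpLamV t u))
    (topw n OpLam t u).

Lemma computable_tdispatch n f g h :
  computable f -> computable g -> computable h ->
  computable (fun t => tdispatch n (f t) (g t) (h t)).
Proof. by move=> cf cg ch; rewrite /tdispatch; computable. Qed.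
#[local] Hint Resolve computable_tdispatch : computable.

Lemma tdispatchE n o t u : tdispatch n (code_op o) t u = topw n o t u.
Proof. by case: o. Qed.

Definition teval n t :=
  drec (fun=> Leaf) (fun z =>
    let t1 := tfst (tfst (tsnd z)) in let t2 := tsnd (tfst (tsnd z)) in
    let v := tsnd (tsnd (tsnd (tsnd z))) in
    tif t1 (tdispatch n (tsnd t1) (tfst v) (tsnd v))
      (Node (Node (Node ttrue t2) Leaf) Leaf)) Leaf t.

Lemma computable_teval n f : computable f -> computable (fun t => teval n (f t)).
Proof. by move=> cf; rewrite /teval /ttrue; computable. Qed.
#[local] Hint Resolve computable_teval : computable.

Lemma tevalE n (X : Type) (c : X -> nat) (t : term X) :
  teval n (code_term c t) = code_word (eval_word n c t).
Proof.
rewrite /teval; elim: t => [//|o t1 IH1 t2 IH2].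
rewrite [code_term _ _]/= drec_Node (dval_Node _ _ _ (code_term c t1)).
rewrite [LHS]/= IH1 IH2.
by rewrite tdispatchE topwE.
Qed.

Lemma eval_word_eq_computable n :
  exists p, forall (X : Type) (c : X -> nat) (s t : term X),
    exec p (Node (code_term c s) (code_term c t))
      (code_bool (nf n (eval_word n c s) == nf n (eval_word n c t))).
Proof.
have [p Hp] : computable (fun z =>
    teq (tnf n (teval n (tfst z))) (tnf n (teval n (tsnd z)))) by computable.
exists p => X c s t; move: (Hp (Node (code_term c s) (code_term c t))).
rewrite /= !tevalE !tnfE /teq.
by rewrite (inj_eq code_word_inj); case: eqP.
Qed.

(** * The word problem *)

Section Morphism.
Variables (K L : solution) (f : K -> L).
Hypothesis fM : is_morphism f.

Lemma morphism_op_val o (x y : K) : f (op_val o x y) = op_val o (f x) (f y).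
Proof.
have flam u v : f (lam u v) = lam (f u) (f v) by rewrite [RHS]/lam fM.
have frho u v : f (rho u v) = rho (f u) (f v) by rewrite [RHS]/rho fM.
have frV u v : rV (f u, f v) = (f (rV (u, v)).1, f (rV (u, v)).2).
  apply: (can_inj (@rK L)); rewrite fM rVK.
  by rewrite -surjective_pairing rVK.
case: o => /=; rewrite ?frV //.
- by apply: (can_inj (lamK (f x))); rewrite -flam !lamVK.
- by apply: (can_inj (rhoK (f x))); rewrite -frho !rhoVK.
Qed.

Lemma morphism_term_val (X : Type) (i : X -> K) (t : term X) :
  f (term_val i t) = term_val (f \o i) t.
Proof. by elim: t => //= o t1 <- t2 <-; rewrite morphism_op_val. Qed.
End Morphism.

Lemma eq_term_val (X : Type) (K : solution) (i j : X -> K) (t : term X) :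
  i =1 j -> term_val i t = term_val j t.
Proof. by move=> ij; elim: t => //= o t1 -> t2 ->. Qed.

(** Undoes the labelling [c] on the generators of [t], when their labels are distinct; [d] is the
    value at foreign labels. *)
Fixpoint lookup (X Y : Type) (c : X -> nat) (i : X -> Y) (d : Y) (t : term X)
    (k : nat) : Y :=
  match t with
  | Var x => if c x == k then i x else d
  | App _ t1 t2 => lookup c i (lookup c i d t2 k) t1 k
  end.

Lemma lookupE (X Y : Type) (c : X -> nat) (i : X -> Y) d t k z :
  (forall y, occurs y t -> c y = k -> i y = z) ->
  d = z \/ (exists2 x, occurs x t & c x = k) ->
  lookup c i d t k = z.
Proof.
elim: t d => [x|o t1 IH1 t2 IH2] d H Hd /=.
  case: eqP => [/H->|ne] //; case: Hd => // -[y /= -> ] //.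
apply: IH1 => [y Hy|]; first by apply: H; left.
case: Hd => [Hd|[x [Hx|Hx] cx]].
- by left; apply: IH2 => [y Hy|]; [apply: H; right | left].
- by right; exists x.
- by left; apply: IH2 => [y Hy|]; [apply: H; right | right; exists x].
Qed.

Theorem theoremE (n : nat) (hn : 1 <= n) (X : Type) (hX : inhabited X)
    (F : solution) (i : X -> F) (hF : is_free_injective n i) :
  word_problem_solvable i.
Proof.
case: hF => injF nilF freeF; case: hX => x0.
have [p Hp] := eval_word_eq_computable n.
exists p => s t c c_inj; eexists; split; first exact: Hp.
split=> [/nf_eqP st | st].
(* Joining [s] and [t] by an arbitrary operation gives one assignment of labels for both; [i x0] is
   a dummy value. *)
- pose g := lookup c i (i x0) (App OpLam s t).
  have gE x : occurs x (App OpLam s t) -> g (c x) = i x.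
    move=> Hx; apply: lookupE => [y Hy cyx|]; last by right; exists x.
    by congr i; exact: c_inj.
  case: n hn nilF st {Hp freeF} => // n _ nilF st.
  have Rs := @represents_eval_word F injF g n nilF X c i s
    (fun x Hx => gE x (or_introl Hx)).
  have Rt := @represents_eval_word F injF g n nilF X c i t
    (fun x Hx => gE x (or_intror Hx)).
  exact: (represents_inj injF (represents_weq injF nilF st Rs) Rt).
(* The morphism extending the labelled generators preserves term values, so an equality in F
   persists in L_n. *)
- have [] := freeF (word_solution n) (@brace_solution_injective _)
    (word_solution_RNS hn) (@gen n \o c).
  move=> phi [phiM phii _]; apply/nf_eqP/mk_eq.
  rewrite -!term_val_word_solution -!(eq_term_val _ phii).
  by rewrite -!morphism_term_val // st.
Qed.
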